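(* If a framework $(\mathcal G(A,D),p)$ in $\mathbb R^2$ is constructed by an SA-RoD ordering, then it is globally SA-RoD rigid.
   Context: $\mathcal{G}=(\mathcal V,\mathcal E)$ is a finite simple undirected graph, $\mathcal V=\{1,\dots,n\}$, $n\ge 3$. A node bipartition is $\mathcal V=\mathcal V_A\cup\mathcal V_D$ with $\mathcal V_A,\mathcal V_D$ disjoint and (for the constructed framework) nonempty; $\mathcal G(A,D)$ is $\mathcal G$ with this bipartition and $\mathcal K(A,D)$ is the complete graph on $\mathcal V$ with the same bipartition. A framework has configuration $p=(p_1^\top,\dots,p_n^\top)^\top\in\mathbb R^{2n}$ with pairwise distinct $p_i\in\mathbb R^2$. $b_{ij}=(p_j-p_i)/\|p_j-p_i\|$. $\mathcal T_A=\{(u,v,w)\in\mathcal V^3: u\in\mathcal V_A,(u,v),(u,w)\in\mathcal E,v<w\}$, $\mathcal T_D$ likewise with $u\in\mathcal V_D$. $\alpha_{rst}\in[0,2\pi)$ is the counter-clockwise signed angle from $b_{rs}$ to $b_{rt}$; $\kappa_{ijk}=\|p_k-p_i\|/\|p_j-p_i\|$. $f_{\mathcal G(A,D)}(p)=(\ldots,\alpha_{rst},\ldots,\kappa_{ijk},\ldots)^\top$, $(r,s,t)\in\mathcal T_A$, $(i,j,k)\in\mathcal T_D$, defined where adjacent vertices are distinct; likewise $f_{\mathcal K(A,D)}$. The framework is globally SA-RoD rigid if $f^{-1}_{\mathcal{G}(A,D)}(f_{\mathcal{G}(A,D)}(p))=f^{-1}_{\mathcal{K}(A,D)}(f_{\mathcal{K}(A,D)}(p))$.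 SA-RoD ordering: start with $\mathcal V=\{1,2\}$, points $p_1\neq p_2$, $\mathcal E=\{(1,2)\}$, each of $1,2$ assigned to $\mathcal V_A$ or $\mathcal V_D$; then repeatedly perform either a 1-vertex addition or a 2-vertex addition, until the desired number of vertices is reached. New vertices are assigned to one of the two parts; old vertices keep their part ($\mathcal V_A\subseteq\mathcal V_A'$, $\mathcal V_D\subseteq\mathcal V_D'$); all points remain pairwise distinct. 1-vertex addition (current vertices $1,\dots,n$): add vertex $n+1$ with position $p_{n+1}$ and two edges joining $n+1$ to two distinct existing vertices $i,j$, in one of the following ways: Type $A_1$: $n+1\in\mathcal V_A'$, and $i\in\mathcal V_D$ or $j\in\mathcal V_D$. Type $D_1$: $n+1\in\mathcal V_D'$, and $i\in\mathcal V_A$ or $j\in\mathcal V_A$. Type $A_2$: $n+1\in\mathcal V_A'$, $i,j\in\mathcal V_A$, and $p_i,p_j,p_{n+1}$ are non-collinear. Type $D_2$: $n+1\in\mathcal V_D'$, $i,j\in\mathcal V_D$, and for a third existing vertex $k\in\mathcal V_D$ such that $p_i,p_j,p_k$ are non-collinear, a third edge $(n+1,k)$ is also added. 2-vertex addition (current vertices $1,\dots,n$): add vertices $n+1,n+2$ with positions and three edges $(j,n+1),(n+1,n+2),(n+2,i)$, where $i\ne j$ are existing vertices, such that exactly three of the vertices $i,j,n+1,n+2$ belong to $\mathcal V_A'$, these three are non-collinear, and the remaining one belongs to $\mathcal V_D'$. *)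

(* Defs.v *)
From HB Require Import structures.
From mathcomp Require Import all_boot all_order all_algebra.
From mathcomp Require Import ring lra.
From mathcomp Require Import boolp classical_sets reals trigo.

Set Implicit Arguments.
Unset Strict Implicit.
Unset Printing Implicit Defensive.
Import Order.TTheory GRing.Theory Num.Theory.
Local Open Scope ring_scope.

(* Plane geometry. The norm is Euclidean, unlike the library's norm `|v| on
   row vectors, which is the sup norm. *)

Definition dot (R : realType) (u v : 'rV[R]_2) : R := \sum_(k < 2) u 0 k * v 0 k.

Definition cross (R : realType) (u v : 'rV[R]_2) : R :=
  u 0 0 * v 0 1 - u 0 1 * v 0 0.

Definition enorm (R : realType) (u : 'rV[R]_2) : R := Num.sqrt (dot u u).

Definition bearing (R : realType) (x y : 'rV[R]_2) : 'rV[R]_2 :=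
  (enorm (y - x))^-1 *: (y - x).

(* Counter-clockwise angle in [0, 2 pi) from the unit vector b to the unit
   vector c; see ccw_angleP. *)
Definition ccw_angle (R : realType) (b c : 'rV[R]_2) : R :=
  if 0 <= cross b c then acos (dot b c) else 2 * pi - acos (dot b c).

Lemma ccw_angleP (R : realType) (b c : 'rV[R]_2) :
  dot b b = 1 -> dot c c = 1 ->
  [/\ 0 <= ccw_angle b c < 2 * pi,
      c 0 0 = cos (ccw_angle b c) * b 0 0 - sin (ccw_angle b c) * b 0 1 &
      c 0 1 = sin (ccw_angle b c) * b 0 0 + cos (ccw_angle b c) * b 0 1].
Proof.
have i1 : lift ord0 ord0 = 1 :> 'I_2 by apply/val_inj.
move=> hb hc.
have lagr : dot b c ^+ 2 + cross b c ^+ 2 = 1.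
  transitivity (dot b b * dot c c); last by rewrite hb hc mulr1.
  rewrite /dot /cross !big_ord_recl !big_ord0 i1; ring.
have d1 : -1 <= dot b c <= 1.
  by rewrite -ler_norml -(@expr_le1 _ 2) // real_normK ?num_real //;
     have := sqr_ge0 (cross b c); lra.
have pi0 := @pi_gt0 R.
have a0 := acos_ge0 d1.
have api := acos_lepi d1.
have cosE : cos (ccw_angle b c) = dot b c.
  rewrite /ccw_angle; case: ifP => _; first by rewrite acosK.
  by rewrite mulr_natl addrC cosD2pi cosN acosK.
have sinE : sin (ccw_angle b c) = cross b c.
  have h : 1 - dot b c ^+ 2 = cross b c ^+ 2 by lra.
  rewrite /ccw_angle; case: ifPn => hx; last rewrite mulr_natl addrC sinD2pi sinN.
    by rewrite sin_acos // h sqrtr_sqr ger0_norm.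
  by rewrite sin_acos // h sqrtr_sqr ltr0_norm ?ltNge // opprK.
have hb' : b 0 0 ^+ 2 + b 0 1 ^+ 2 = 1.
  by rewrite -hb /dot !big_ord_recl big_ord0 i1; ring.
split.
- rewrite /ccw_angle; case: ifPn => hx; first by apply/andP; split; lra.
  have : 0 < acos (dot b c).
    apply: acos_gt0; case/andP: d1 => -> /=; rewrite lt_neqAle => ->; rewrite andbT.
    apply: contra hx => /eqP h1; rewrite h1 in lagr.
    have /eqP : cross b c ^+ 2 = 0 by lra.
    by rewrite sqrf_eq0 => /eqP ->.
  by move=> ?; apply/andP; split; lra.
- rewrite cosE sinE -[LHS]mul1r -hb' /dot /cross !big_ord_recl big_ord0 i1; ring.
- rewrite cosE sinE -[LHS]mul1r -hb' /dot /cross !big_ord_recl big_ord0 i1; ring.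
Qed.

Definition collinear (R : realType) (n : nat) (p : 'I_n -> 'rV[R]_2)
    (S : {set 'I_n}) : Prop :=
  exists a d : 'rV[R]_2, d != 0 /\
    forall i, i \in S -> exists t : R, p i = a + t *: d.

Record sgraph (n : nat) := SGraph {
  adj :> rel 'I_n;
  adj_sym : symmetric adj;
  adj_irrefl : irreflexive adj }.

Definition complete_rel (n : nat) : rel 'I_n := fun u v => u != v.

Lemma complete_sym (n : nat) : symmetric (@complete_rel n).
Proof. by move=> u v; rewrite /complete_rel eq_sym. Qed.

Lemma complete_irrefl (n : nat) : irreflexive (@complete_rel n).
Proof. by move=> u; rewrite /complete_rel eqxx. Qed.

Definition complete_graph (n : nat) : sgraph n :=
  SGraph (@complete_sym n) (@complete_irrefl n).

(* The bipartition is given by its part V_A, the part V_D being the complement.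
   A part may be empty here: this does occur at the start of an ordering. *)
Record framework (R : realType) (n : nat) := Framework {
  graph : sgraph n;
  partA : {set 'I_n};
  pos : 'I_n -> 'rV[R]_2;
  pos_inj : injective pos }.

Definition partD (R : realType) (n : nat) (F : framework R n) : {set 'I_n} :=
  ~: partA F.

Definition triples (n : nat) (G : sgraph n) (U : {set 'I_n}) :
    {set 'I_n * 'I_n * 'I_n} :=
  [set t | [&& t.1.1 \in U, G t.1.1 t.1.2, G t.1.1 t.2 & (t.1.2 < t.2)%N]].

Definition alpha (R : realType) (n : nat) (q : 'I_n -> 'rV[R]_2)
    (t : 'I_n * 'I_n * 'I_n) : R :=
  let: (r, s, t) := t in ccw_angle (bearing (q r) (q s)) (bearing (q r) (q t)).

Definition kappa (R : realType) (n : nat) (q : 'I_n -> 'rV[R]_2)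
    (t : 'I_n * 'I_n * 'I_n) : R :=
  let: (i, j, k) := t in enorm (q k - q i) / enorm (q j - q i).

Definition sarod_map (R : realType) (n : nat) (G : sgraph n) (A D : {set 'I_n})
    (q : 'I_n -> 'rV[R]_2) :
    {ffun {t | t \in triples G A} -> R} * {ffun {t | t \in triples G D} -> R} :=
  ([ffun t => alpha q (val t)], [ffun t => kappa q (val t)]).

Definition sarod_dom (R : realType) (n : nat) (G : sgraph n) :
    set ('I_n -> 'rV[R]_2) :=
  [set q | forall u v, G u v -> q u != q v]%classic.

(* The fibre of q under the partial map that is sarod_map restricted to
   sarod_dom. *)
Definition sarod_fibre (R : realType) (n : nat) (G : sgraph n) (A D : {set 'I_n})
    (q : 'I_n -> 'rV[R]_2) : set ('I_n -> 'rV[R]_2) :=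
  (@sarod_dom R n G `&` sarod_map G A D @^-1` [set sarod_map G A D q])%classic.

Definition globally_sarod_rigid (R : realType) (n : nat) (F : framework R n) :
    Prop :=
  sarod_fibre (graph F) (partA F) (partD F) (pos F) =
  sarod_fibre (complete_graph n) (partA F) (partD F) (pos F).

(* F' has the n vertices of F, embedded by lshift k, with the same edges, parts
   and positions, and k new vertices, the images of rshift n. *)
Definition extends (R : realType) (n k : nat) (F : framework R n)
    (F' : framework R (n + k)) : Prop :=
  [/\ forall u v : 'I_n, graph F' (lshift k u) (lshift k v) = graph F u v,
      forall u : 'I_n, (lshift k u \in partA F') = (u \in partA F) &
      forall u : 'I_n, pos F' (lshift k u) = pos F u].

Definition joined_to (R : realType) (n k : nat) (F' : framework R (n + k))
    (x : 'I_k) (N : {set 'I_n}) : Prop :=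
  forall u : 'I_n, graph F' (rshift n x) (lshift k u) = (u \in N).

Definition type_A1 (R : realType) (n : nat) (F : framework R n)
    (F' : framework R (n + 1)) (i j : 'I_n) : Prop :=
  [/\ joined_to F' ord0 [set i; j], rshift n ord0 \in partA F' &
      i \in partD F \/ j \in partD F].

Definition type_D1 (R : realType) (n : nat) (F : framework R n)
    (F' : framework R (n + 1)) (i j : 'I_n) : Prop :=
  [/\ joined_to F' ord0 [set i; j], rshift n ord0 \in partD F' &
      i \in partA F \/ j \in partA F].

Definition type_A2 (R : realType) (n : nat) (F : framework R n)
    (F' : framework R (n + 1)) (i j : 'I_n) : Prop :=
  [/\ joined_to F' ord0 [set i; j], rshift n ord0 \in partA F',
      i \in partA F, j \in partA F &
      ~ collinear (pos F') [set lshift 1 i; lshift 1 j; rshift n ord0]].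

Definition type_D2 (R : realType) (n : nat) (F : framework R n)
    (F' : framework R (n + 1)) (i j : 'I_n) : Prop :=
  exists k : 'I_n,
    [/\ k != i, k != j & joined_to F' ord0 [set i; j; k]] /\
    [/\ rshift n ord0 \in partD F', i \in partD F, j \in partD F,
        k \in partD F & ~ collinear (pos F) [set i; j; k]].

Definition one_vertex_addition (R : realType) (n : nat) (F : framework R n)
    (F' : framework R (n + 1)) : Prop :=
  extends F F' /\
  exists i j : 'I_n, i != j /\
    [\/ type_A1 F F' i j, type_D1 F F' i j, type_A2 F F' i j | type_D2 F F' i j].

Definition two_vertex_addition (R : realType) (n : nat) (F : framework R n)
    (F' : framework R (n + 2)) : Prop :=
  let new1 : 'I_(n + 2) := rshift n ord0 in
  let new2 : 'I_(n + 2) := rshift n ord_max in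
  extends F F' /\
  exists i j : 'I_n,
    let Q := [set lshift 2 i; lshift 2 j; new1; new2] in
    [/\ i != j,
        [/\ joined_to F' ord0 [set j], graph F' new1 new2 &
            joined_to F' ord_max [set i]],
        #|Q :&: partA F'| = 3%N,
        ~ collinear (pos F') (Q :&: partA F') &
        #|Q :&: partD F'| = 1%N].

Inductive sarod_ordering (R : realType) :
    forall n : nat, framework R n -> Prop :=
| SarodBase (F : framework R 2) :
    graph F ord0 ord_max -> sarod_ordering F
| SarodOne (n : nat) (F : framework R n) (F' : framework R (n + 1)) :
    sarod_ordering F -> one_vertex_addition F F' -> sarod_ordering F'
| SarodTwo (n : nat) (F : framework R n) (F' : framework R (n + 2)) :
    sarod_ordering F -> two_vertex_addition F F' -> sarod_ordering F'.

(* Main.v *)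
(* Every realization with the same measurements as p on the edges of G is the
   image of p under a direct similarity z |-> c z + d, and direct similarities
   preserve all signed angles and distance ratios. The similarity is found by
   induction along the ordering. Undoing the similarity given by the induction
   hypothesis, the old points may be assumed to coincide. Since each old vertex
   has an old neighbour, an old vertex in V_A then fixes the bearing of the new
   point joined to it, and an old vertex in V_D fixes the distance. Together
   with the measurement at the new vertices this determines the new points. *)
Require Import Defs.
From mathcomp Require Import all_boot all_order all_algebra.
From mathcomp Require Import ring lra.
From mathcomp Require Import boolp classical_sets reals trigo.

Set Implicit Arguments.
Unset Strict Implicit.
Unset Printing Implicit Defensive.
Import Order.TTheory GRing.Theory Num.Theory.
Local Open Scope ring_scope.

(** * Vectors, bearings, signed angles and distance ratios in the plane *)

Section Plane.
Variable R : realType.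
Implicit Types (a b c u v w x y z : 'rV[R]_2) (r s : R).

Lemma vec2P u v : u 0 0 = v 0 0 -> u 0 1 = v 0 1 -> u = v.
Proof.
move=> h0 h1; apply/rowP => i.
by have [->|->] : i = 0 \/ i = 1 by case: i => [[|[|//]] ?]; [left|right]; apply: val_inj.
Qed.

Lemma dotE u v : dot u v = u 0 0 * v 0 0 + u 0 1 * v 0 1.
Proof.
rewrite /dot !big_ord_recl big_ord0 addr0.
by have -> : lift ord0 ord0 = 1 :> 'I_2 by apply/val_inj.
Qed.

Lemma dotC u v : dot u v = dot v u.
Proof. by rewrite !dotE; ring. Qed.

Lemma crossC u v : cross u v = - cross v u.
Proof. by rewrite /cross; ring. Qed.

Lemma crossNN u v : cross (- u) (- v) = cross u v.
Proof. by rewrite /cross !mxE; ring. Qed.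

Lemma dotZ r s u v : dot (r *: u) (s *: v) = r * s * dot u v.
Proof. by rewrite !dotE !mxE; ring. Qed.

Lemma crossZ r s u v : cross (r *: u) (s *: v) = r * s * cross u v.
Proof. by rewrite /cross !mxE; ring. Qed.

Lemma dot_ge0 u : 0 <= dot u u.
Proof. by rewrite dotE -!expr2 addr_ge0 ?sqr_ge0. Qed.

Lemma dot_eq0 u : (dot u u == 0) = (u == 0).
Proof.
rewrite dotE -!expr2 paddr_eq0 ?sqr_ge0 // !sqrf_eq0.
apply/andP/eqP => [[/eqP h0 /eqP h1]|->]; last by rewrite !mxE.
by apply: vec2P; rewrite mxE.
Qed.

Lemma enorm_sqr u : enorm u ^+ 2 = dot u u.
Proof. by rewrite sqr_sqrtr ?dot_ge0. Qed.

Lemma enorm_eq0 u : (enorm u == 0) = (u == 0).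
Proof. by rewrite -sqrf_eq0 enorm_sqr dot_eq0. Qed.

Lemma enormN u : enorm (- u) = enorm u.
Proof. by rewrite /enorm -scaleN1r dotZ mulrNN !mul1r. Qed.

Lemma enormB u v : enorm (u - v) = enorm (v - u).
Proof. by rewrite -opprB enormN. Qed.

Lemma bearing_unit x y : x != y -> dot (bearing x y) (bearing x y) = 1.
Proof.
move=> xy; have ne : enorm (y - x) != 0 by rewrite enorm_eq0 subr_eq0 eq_sym.
by rewrite dotZ -enorm_sqr; field.
Qed.

Lemma bearingC x y : bearing x y = - bearing y x.
Proof. by rewrite /bearing enormB -scalerN opprB. Qed.

Lemma bearingC_inj x y x' y' : bearing x y = bearing x' y' -> bearing y x = bearing y' x'.
Proof. by rewrite (bearingC y) (bearingC y') => ->. Qed.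

Lemma bearing_dirE x y x' y' :
  x != y -> x' != y' -> bearing x y = bearing x' y' ->
  y - x = (enorm (y - x) / enorm (y' - x')) *: (y' - x').
Proof.
move=> xy xy' h; have ne : enorm (y - x) != 0 by rewrite enorm_eq0 subr_eq0 eq_sym.
by rewrite -scalerA -[X in _ *: X]h scalerA divff // scale1r.
Qed.

(** Cosine and sine stand for the signed angle: exchanging the arms only changes the sign of the
    sine, whereas a value in [0, 2 pi) would need a separate case at 0. *)
Definition same_angle u v w u' v' w' : Prop :=
  dot (bearing u v) (bearing u w) = dot (bearing u' v') (bearing u' w') /\
  cross (bearing u v) (bearing u w) = cross (bearing u' v') (bearing u' w').

(** Equality of the two ratios with denominators cleared, which makes it symmetric in the two
    arms. *)
Definition same_ratio u v w u' v' w' : Prop :=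
  enorm (w - u) * enorm (v' - u') = enorm (w' - u') * enorm (v - u).

Lemma same_angleC u v w u' v' w' :
  same_angle u v w u' v' w' -> same_angle u w v u' w' v'.
Proof.
by move=> [hd hc]; split; [rewrite dotC hd dotC|rewrite crossC hc -crossC].
Qed.

Lemma same_ratioC u v w u' v' w' :
  same_ratio u v w u' v' w' -> same_ratio u w v u' w' v'.
Proof. by rewrite /same_ratio => h; rewrite mulrC -h mulrC. Qed.

(** By [ccw_angleP] the second vector is the first one rotated by the angle, so [dot] and [cross]
    are the cosine and the sine of that angle. *)
Lemma ccw_angle_inj a b a' b' :
  dot a a = 1 -> dot b b = 1 -> dot a' a' = 1 -> dot b' b' = 1 ->
  ccw_angle a b = ccw_angle a' b' ->
  dot a b = dot a' b' /\ cross a b = cross a' b'.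
Proof.
move=> ha hb ha' hb' h.
have [_ e0 e1] := ccw_angleP ha hb; have [_ f0 f1] := ccw_angleP ha' hb'.
move: ha ha'; rewrite !dotE /cross e0 e1 f0 f1 h => ha ha'; split.
  transitivity (cos (ccw_angle a' b')); last rewrite -[LHS]mulr1 -ha'; last by ring.
  by rewrite -[RHS]mulr1 -ha; ring.
transitivity (sin (ccw_angle a' b')); last rewrite -[LHS]mulr1 -ha'; last by ring.
by rewrite -[RHS]mulr1 -ha; ring.
Qed.

(** For a unit vector [a], [dot a] and [cross a] are the coordinates in the orthonormal frame formed
    by [a] and its quarter turn. *)
Lemma dot_cross_inj a b c : dot a a = 1 ->
  dot a b = dot a c -> cross a b = cross a c -> b = c.
Proof.
rewrite !dotE /cross => h hd hc; apply: vec2P.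
  rewrite -[LHS]mul1r -[RHS]mul1r -h.
  transitivity (a 0 0 * (a 0 0 * b 0 0 + a 0 1 * b 0 1) - a 0 1 * (a 0 0 * b 0 1 - a 0 1 * b 0 0)).
    by ring.
  by rewrite hd hc; ring.
rewrite -[LHS]mul1r -[RHS]mul1r -h.
transitivity (a 0 1 * (a 0 0 * b 0 0 + a 0 1 * b 0 1) + a 0 0 * (a 0 0 * b 0 1 - a 0 1 * b 0 0)).
  by ring.
by rewrite hd hc; ring.
Qed.

Lemma same_angle_bearing u v w u' v' w' : u != v ->
  same_angle u v w u' v' w' -> bearing u v = bearing u' v' ->
  bearing u w = bearing u' w'.
Proof.
move=> uv [hd hc] e; move: hd hc; rewrite -e; apply: dot_cross_inj.
exact: bearing_unit.
Qed.

(* Row vectors are read as complex numbers: the direct similarities are the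
   maps z |-> c z + d with c != 0. *)
Definition cmul u v : 'rV[R]_2 :=
  \row_(k < 2) (if k == 0 then u 0 0 * v 0 0 - u 0 1 * v 0 1
                else u 0 1 * v 0 0 + u 0 0 * v 0 1).

(** The conjugate over the squared modulus; division by 0 gives 0, so [cinv] sends 0 to 0. *)
Definition cinv u : 'rV[R]_2 :=
  \row_(k < 2) ((if k == 0 then u 0 0 else - u 0 1) / dot u u).

Lemma cmulC u v : cmul u v = cmul v u.
Proof. by apply: vec2P; rewrite !mxE /=; ring. Qed.

Lemma cmulA u v w : cmul u (cmul v w) = cmul (cmul u v) w.
Proof. by apply: vec2P; rewrite !mxE /=; ring. Qed.

Lemma cmulBr u v w : cmul u (v - w) = cmul u v - cmul u w.
Proof. by apply: vec2P; rewrite !mxE /=; ring. Qed.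

Lemma cmulVK u v : u != 0 -> cmul (cinv u) (cmul u v) = v.
Proof.
rewrite -dot_eq0 dotE => u0.
by apply: vec2P; rewrite !mxE /= !dotE; field.
Qed.

Lemma dot_cmul c u v : dot (cmul c u) (cmul c v) = dot c c * dot u v.
Proof. by rewrite !dotE !mxE /=; ring. Qed.

Lemma cross_cmul c u v : cross (cmul c u) (cmul c v) = dot c c * cross u v.
Proof. by rewrite !dotE /cross !mxE /=; ring. Qed.

Lemma enorm_cmul c u : enorm (cmul c u) = enorm c * enorm u.
Proof. by rewrite /enorm dot_cmul sqrtrM ?dot_ge0. Qed.

Lemma cmul_eq0 c u : (cmul c u == 0) = (c == 0) || (u == 0).
Proof. by rewrite -!enorm_eq0 enorm_cmul mulf_eq0. Qed.

Lemma cinv_eq0 u : (cinv u == 0) = (u == 0).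
Proof.
have [->|u0] := eqVneq u 0; first by apply/eqP/vec2P; rewrite !mxE /=; ring.
by apply/eqP => h; move/eqP: (u0); apply; rewrite -(cmulVK u u0) h; apply/eqP; rewrite cmul_eq0 eqxx.
Qed.

Lemma cmulKV u v : u != 0 -> cmul u (cmul (cinv u) v) = v.
Proof. by move=> u0; rewrite cmulA (cmulC u) -cmulA cmulVK. Qed.

(** * Direct similarities and their action on bearings *)

Definition csim c d u : 'rV[R]_2 := cmul c u + d.

Lemma csimB c d u v : csim c d u - csim c d v = cmul c (u - v).
Proof. by rewrite /csim cmulBr opprD addrACA subrr addr0. Qed.

Lemma csim_inj c d : c != 0 -> injective (csim c d).
Proof.
move=> c0 u v /addIr /(congr1 (cmul (cinv c))); by rewrite !cmulVK.
Qed.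

(** A direct similarity turns all bearings by the same unit complex number, [c] over its modulus;
    invariance of signed angles follows. *)
Lemma bearing_csim c d u v :
  bearing (csim c d u) (csim c d v) = (enorm c)^-1 *: cmul c (bearing u v).
Proof.
rewrite /bearing csimB enorm_cmul invfM -scalerA; congr (_ *: _).
by apply: vec2P; rewrite !mxE /=; ring.
Qed.

Lemma csim_dot c d u v w : c != 0 ->
  dot (bearing (csim c d u) (csim c d v)) (bearing (csim c d u) (csim c d w)) =
  dot (bearing u v) (bearing u w).
Proof.
rewrite -enorm_eq0 => c0.
by rewrite !bearing_csim dotZ dot_cmul -enorm_sqr; field.
Qed.

Lemma csim_cross c d u v w : c != 0 ->
  cross (bearing (csim c d u) (csim c d v)) (bearing (csim c d u) (csim c d w)) =
  cross (bearing u v) (bearing u w).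
Proof.
rewrite -enorm_eq0 => c0.
by rewrite !bearing_csim crossZ cross_cmul -enorm_sqr; field.
Qed.

(* From here on x is the given position of a new point and y its position in
   another realization with the same measurements. *)

Lemma ray_meet i j x y r s : cross (x - i) (x - j) != 0 ->
  y - i = r *: (x - i) -> y - j = s *: (x - j) -> y = x /\ r = 1.
Proof.
move=> hc hi hj.
have e0 := congr1 (fun v => v 0 0) hi; have e1 := congr1 (fun v => v 0 1) hi.
have f0 := congr1 (fun v => v 0 0) hj; have f1 := congr1 (fun v => v 0 1) hj.
rewrite /cross !mxE in hc e0 e1 f0 f1.
suff r1 : r = 1.
  by split=> //; move: hi; rewrite r1 scale1r => /addIr.
apply/eqP; rewrite -subr_eq0 -(mulIr_eq0 _ (mulIf hc)); apply/eqP.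
(* The vector [y - x] is both [(r - 1) *: (x - i)] and [(s - 1) *: (x - j)]; taking the cross
   product with [x - j] kills the second form and leaves [(r - 1)] times the nonzero [cross]. *)
have g0 : (r - 1) * (x 0 0 - i 0 0) = (s - 1) * (x 0 0 - j 0 0) by lra.
have g1 : (r - 1) * (x 0 1 - i 0 1) = (s - 1) * (x 0 1 - j 0 1) by lra.
transitivity ((r - 1) * (x 0 0 - i 0 0) * (x 0 1 - j 0 1)
   - (r - 1) * (x 0 1 - i 0 1) * (x 0 0 - j 0 0)); first by ring.
by rewrite g0 g1; ring.
Qed.

Lemma bearing_enorm i x y :
  i != x -> i != y -> bearing i y = bearing i x -> enorm (y - i) = enorm (x - i) -> y = x.
Proof.
move=> ix iy hb he; have := bearing_dirE iy ix hb.
by rewrite he divff ?enorm_eq0 ?subr_eq0 1?eq_sym // scale1r => /addIr.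
Qed.

Lemma bearing_meet i j x y :
  i != x -> i != y -> j != x -> j != y -> cross (x - i) (x - j) != 0 ->
  bearing i y = bearing i x -> bearing j y = bearing j x -> y = x.
Proof.
move=> ix iy jx jy hc hi hj.
by have [] := ray_meet hc (bearing_dirE iy ix hi) (bearing_dirE jy jx hj).
Qed.

(* Equal distances to i and j leave x and its mirror image, which the sign of
   the angle at the new point tells apart. *)
Lemma dist_angle i j x y :
  i != j -> i != x -> i != y -> j != x -> j != y ->
  enorm (y - i) = enorm (x - i) -> enorm (y - j) = enorm (x - j) ->
  same_angle y i j x i j -> y = x.
Proof.
move=> ij ix iy jx jy di dj [_]; rewrite /bearing !crossZ.
rewrite ![enorm (i - _)]enormB ![enorm (j - _)]enormB di dj => h.
have ni : (enorm (x - i))^-1 != 0 by rewrite invr_eq0 enorm_eq0 subr_eq0 eq_sym.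
have nj : (enorm (x - j))^-1 != 0 by rewrite invr_eq0 enorm_eq0 subr_eq0 eq_sym.
have {h} hc := mulfI (mulf_neq0 ni nj) h.
have ei : dot (y - i) (y - i) = dot (x - i) (x - i) by rewrite -!enorm_sqr di.
have ej : dot (y - j) (y - j) = dot (x - j) (x - j) by rewrite -!enorm_sqr dj.
have dn : dot (j - i) (j - i) != 0 by rewrite dot_eq0 subr_eq0 eq_sym.
(* Subtracting the two squared distance equations removes the quadratic terms: [x] and [y] have the
   same projection on the line through [i] and [j]. *)
have hD : dot (j - i) y = dot (j - i) x.
  by move: ei ej; rewrite !dotE !mxE => ei ej; nra.
(* The oriented areas [hc] of the triangles at [y] and [x] fix the component orthogonal to that
   line, hence also its side. *)
have hC : cross (j - i) y = cross (j - i) x.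
  by move: hc; rewrite /cross !mxE => hc; lra.
move: dn hD hC; rewrite /cross !dotE => dn hD hC.
set d := j - i in dn hD hC.
have lag z : (d 0 0 * d 0 0 + d 0 1 * d 0 1) * z 0 0 =
   d 0 0 * (d 0 0 * z 0 0 + d 0 1 * z 0 1) - d 0 1 * (d 0 0 * z 0 1 - d 0 1 * z 0 0) by ring.
have lag' z : (d 0 0 * d 0 0 + d 0 1 * d 0 1) * z 0 1 =
   d 0 1 * (d 0 0 * z 0 0 + d 0 1 * z 0 1) + d 0 0 * (d 0 0 * z 0 1 - d 0 1 * z 0 0) by ring.
by apply: vec2P; apply: (mulfI dn); rewrite ?lag ?lag' hD hC.
Qed.

(** Differences of squared distance equations make [y - x] orthogonal to [j - i] and to [k - i],
    which are independent; Cramer's rule then gives [y - x = 0]. *)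
Lemma dist3 i j k x y : cross (i - j) (i - k) != 0 ->
  enorm (y - i) = enorm (x - i) -> enorm (y - j) = enorm (x - j) ->
  enorm (y - k) = enorm (x - k) -> y = x.
Proof.
rewrite -[i - j]opprB -[i - k]opprB crossNN => hc di dj dk.
have ei : dot (y - i) (y - i) = dot (x - i) (x - i) by rewrite -!enorm_sqr di.
have ej : dot (y - j) (y - j) = dot (x - j) (x - j) by rewrite -!enorm_sqr dj.
have ek : dot (y - k) (y - k) = dot (x - k) (x - k) by rewrite -!enorm_sqr dk.
have hj : dot (j - i) (y - x) = 0 by move: ei ej; rewrite !dotE !mxE => ei ej; nra.
have hk : dot (k - i) (y - x) = 0 by move: ei ek; rewrite !dotE !mxE => ei ek; nra.
move: hc hj hk; rewrite /cross !dotE; set a := j - i; set b := k - i; set z := y - x.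
move=> hc hj hk; apply/eqP; rewrite -subr_eq0 -/z; apply/eqP.
apply: vec2P; apply: (mulfI hc); rewrite [(0 : 'rV_2) _ _]mxE mulr0.
  transitivity (b 0 1 * (a 0 0 * z 0 0 + a 0 1 * z 0 1) - a 0 1 * (b 0 0 * z 0 0 + b 0 1 * z 0 1)).
    by ring.
  by rewrite hj hk; ring.
transitivity (a 0 0 * (b 0 0 * z 0 0 + b 0 1 * z 0 1) - b 0 0 * (a 0 0 * z 0 0 + a 0 1 * z 0 1)).
  by ring.
by rewrite hj hk; ring.
Qed.

(** The angle at the new point turns its known bearing to [j] into its bearing to [i], and the
    distance to [i] does the rest. *)
Lemma dist_bearing_angle i j x y :
  i != x -> i != y -> j != x -> j != y ->
  enorm (y - i) = enorm (x - i) -> bearing j y = bearing j x ->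
  same_angle y i j x i j -> y = x.
Proof.
move=> ix iy jx jy di bj /same_angleC ang.
apply: (bearing_enorm ix iy _ di); apply: bearingC_inj.
by apply: same_angle_bearing ang (bearingC_inj bj); rewrite eq_sym.
Qed.

(** The ratio turns the known distance to [j] into the distance to [i], along which the bearing is
    known. *)
Lemma dist_bearing_ratio i j x y :
  i != x -> i != y -> j != x -> j != y ->
  bearing i y = bearing i x -> enorm (y - j) = enorm (x - j) ->
  same_ratio y i j x i j -> y = x.
Proof.
move=> ix iy jx jy bi dj; rewrite /same_ratio ![enorm (j - _)]enormB dj => h.
apply: (bearing_enorm ix iy bi); rewrite enormB [RHS]enormB.
by apply/esym/(mulfI _ h); rewrite enorm_eq0 subr_eq0 eq_sym.
Qed.

(** The ratio forces one common factor on both rays, [y - i = s *: (x - i)] and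
    [y - j = s *: (x - j)]. Subtracting gives [j - i = s *: (j - i)], so [s = 1], even when [x] lies
    on the line through [i] and [j]. *)
Lemma bearing_ratio i j x y :
  i != j -> i != x -> i != y -> j != x -> j != y ->
  bearing i y = bearing i x -> bearing j y = bearing j x ->
  same_ratio y i j x i j -> y = x.
Proof.
move=> ij ix iy jx jy bi bj; rewrite /same_ratio ![enorm (j - _)]enormB ![enorm (i - _)]enormB.
have ni : enorm (x - i) != 0 by rewrite enorm_eq0 subr_eq0 eq_sym.
have nj : enorm (x - j) != 0 by rewrite enorm_eq0 subr_eq0 eq_sym.
have := bearing_dirE iy ix bi; have := bearing_dirE jy jx bj.
set r := _ / _ => ej; set s := _ / _ => ei h.
have rs : r = s.
  rewrite /r /s; apply/eqP; rewrite eqr_div //; apply/eqP; rewrite h; exact: mulrC.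
have e : (j - i) = s *: (j - i).
  transitivity ((y - i) - (y - j)).
    by rewrite opprB [RHS]addrC addrA subrK.
  by rewrite ei ej rs -scalerBr opprB [X in _ *: X]addrC addrA subrK.
have s1 : s = 1.
  have /eqP : (s - 1) *: (j - i) = 0 by rewrite scalerBl scale1r -e subrr.
  by rewrite scaler_eq0 subr_eq0 (subr_eq0 j) (eq_sym j) (negPf ij) orbF => /eqP.
by move: ei; rewrite s1 scale1r => /addIr.
Qed.

(* Path j, x1, x2, i of a 2-vertex addition whose vertex in V_D is i. *)
Lemma quad_end i j x1 x2 y1 y2 :
  j != x1 -> j != y1 -> x1 != x2 -> y1 != y2 -> i != x2 -> i != y2 ->
  cross (x1 - j) (x1 - x2) != 0 ->
  enorm (y2 - i) = enorm (x2 - i) -> bearing j y1 = bearing j x1 ->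
  same_angle y1 j y2 x1 j x2 -> same_angle y2 y1 i x2 x1 i ->
  y1 = x1 /\ y2 = x2.
Proof.
move=> jx jy x12 y12 ix iy hc di bj a1 a2.
(* The angles at the two new points carry the bearing of the first edge along the whole path. *)
have b1 : bearing y1 y2 = bearing x1 x2.
  by apply: same_angle_bearing a1 (bearingC_inj bj); rewrite eq_sym.
have b2 : bearing y2 i = bearing x2 i.
  by apply: same_angle_bearing a2 (bearingC_inj b1); rewrite eq_sym.
have e2 : y2 = x2 by apply: bearing_enorm (bearingC_inj b2) di.
split=> //; rewrite e2 in b1 y12.
(* With [x2] known, [x1] is where the rays from [j] and from [x2] cross. *)
apply: bearing_meet bj (bearingC_inj b1) => //; by rewrite eq_sym.
Qed.

(* The vertex in V_D is x1. *)
Lemma quad_mid i j x1 x2 y1 y2 :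
  j != x1 -> j != y1 -> x1 != x2 -> y1 != y2 -> i != x2 -> i != y2 ->
  cross (x2 - j) (x2 - i) != 0 ->
  bearing i y2 = bearing i x2 -> bearing j y1 = bearing j x1 ->
  same_ratio y1 j y2 x1 j x2 -> same_angle y2 y1 i x2 x1 i ->
  y1 = x1 /\ y2 = x2.
Proof.
move=> jx jy x12 y12 ix iy hc bi bj h a2.
have b2 : bearing y1 y2 = bearing x1 x2.
  apply: bearingC_inj; apply: same_angle_bearing (same_angleC a2) (bearingC_inj bi).
  by rewrite eq_sym.
have ei := bearing_dirE iy ix bi; have ej := bearing_dirE jy jx bj.
have e2 := bearing_dirE y12 x12 b2.
have nj : enorm (x1 - j) != 0 by rewrite enorm_eq0 subr_eq0 eq_sym.
have n2 : enorm (x2 - x1) != 0 by rewrite enorm_eq0 subr_eq0 eq_sym.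
move: h; rewrite /same_ratio ![enorm (j - _)]enormB => h.
have rs : enorm (y2 - y1) / enorm (x2 - x1) = enorm (y1 - j) / enorm (x1 - j).
  by apply/eqP; rewrite eqr_div // h mulrC.
(* The ratio at [x1] scales both of its edges alike, so the homothety with centre [j] taking [x1] to
   [y1] also takes [x2] to [y2]. Thus [y2] lies on the ray from [j] through [x2] as well as on the
   one from [i]. *)
have e : y2 - j = (enorm (y1 - j) / enorm (x1 - j)) *: (x2 - j).
  rewrite -(subrKA y1 y2) e2 {1}ej rs -scalerDr; congr (_ *: _).
  by rewrite subrKA.
have [-> r1] := ray_meet hc e ei; split=> //.
by move: ej; rewrite r1 scale1r => /addIr.
Qed.

End Plane.

(** * Realizations with equal measurements, and rigidity up to direct similarity *)

Section Frameworks.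
Variable R : realType.

(** The fibre condition in working form: the arms may come in either order, and no angle function or
    quotient remains. *)
Definition matches n (G : sgraph n) (A : {set 'I_n}) (p q : 'I_n -> 'rV[R]_2) :=
  [/\ forall u v, G u v -> q u != q v,
      forall u v w, u \in A -> G u v -> G u w -> v != w ->
        same_angle (q u) (q v) (q w) (p u) (p v) (p w) &
      forall u v w, u \notin A -> G u v -> G u w -> v != w ->
        same_ratio (q u) (q v) (q w) (p u) (p v) (p w)].

Lemma adj_neq n (G : sgraph n) u v : G u v -> u != v.
Proof. by apply: contraTneq => ->; rewrite adj_irrefl. Qed.

Lemma pos_adj n (F : framework R n) u v : graph F u v -> pos F u != pos F v.
Proof. by move/adj_neq; rewrite (inj_eq (@pos_inj _ _ F)). Qed.

Lemma fibre_matches n (G : sgraph n) (A : {set 'I_n}) (p q : 'I_n -> 'rV[R]_2) :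
  injective p -> sarod_fibre G A (~: A) p q -> matches G A p q.
Proof.
move=> p_inj [qd /= [/ffunP ea /ffunP ek]].
have pd u v : G u v -> p u != p v by move/adj_neq; rewrite (inj_eq p_inj).
have ang u v w : u \in A -> G u v -> G u w -> (v < w)%N ->
    same_angle (q u) (q v) (q w) (p u) (p v) (p w).
  move=> uA uv uw vw; have ht : (u, v, w) \in triples G A by rewrite inE /= uA uv uw vw.
  have := ea (exist _ (u, v, w) ht); rewrite !ffunE /=.
  by apply: ccw_angle_inj; apply: bearing_unit; rewrite ?qd ?pd.
have rat u v w : u \notin A -> G u v -> G u w -> (v < w)%N ->
    same_ratio (q u) (q v) (q w) (p u) (p v) (p w).
  move=> uA uv uw vw.
  have ht : (u, v, w) \in triples G (~: A) by rewrite inE /= inE uA uv uw vw.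
  have nq : enorm (q v - q u) != 0 by rewrite enorm_eq0 subr_eq0 eq_sym qd.
  have np : enorm (p v - p u) != 0 by rewrite enorm_eq0 subr_eq0 eq_sym pd.
  have := ek (exist _ (u, v, w) ht); rewrite !ffunE /= => /eqP.
  by rewrite eqr_div // => /eqP.
split=> // u v w uA uv uw vw; have [lt|gt|/val_inj e] := ltngtP v w.
- exact: ang.
- exact/same_angleC/ang.
- by rewrite e eqxx in vw.
- exact: rat.
- exact/same_ratioC/rat.
- by rewrite e eqxx in vw.
Qed.

(** This allows a similarity to be undone on [q] without losing the measurements. *)
Lemma matches_csim n (G : sgraph n) (A : {set 'I_n}) (p q : 'I_n -> 'rV[R]_2) c d :
  c != 0 -> matches G A p q -> matches G A p (csim c d \o q).
Proof.
move=> c0 [qd qa qr]; split=> [u v uv|u v w uA uv uw vw|u v w uA uv uw vw] /=.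
- by rewrite (inj_eq (csim_inj c0)) qd.
- by rewrite /same_angle csim_dot // csim_cross //; apply: qa.
- have := qr _ _ _ uA uv uw vw; rewrite /same_ratio !csimB !enorm_cmul => h.
  by rewrite -mulrA h mulrCA.
Qed.

(** The graph is arbitrary, so the lemma serves both the given graph and the complete one. *)
Lemma csim_fibre n (G : sgraph n) (A D : {set 'I_n}) (p q : 'I_n -> 'rV[R]_2) c d :
  injective p -> c != 0 -> (forall u, q u = csim c d (p u)) -> sarod_fibre G A D p q.
Proof.
move=> p_inj c0 qE; split=> [u v uv|].
  by rewrite !qE (inj_eq (csim_inj c0)) (inj_eq p_inj) (adj_neq uv).
rewrite /= /sarod_map; congr (_, _); apply/ffunP => -[[[u v] w] h]; rewrite !ffunE /= !qE.
  by rewrite /ccw_angle csim_dot // csim_cross.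
by rewrite !csimB !enorm_cmul -mulf_div divff ?enorm_eq0 // mul1r.
Qed.

(** The induction invariant. Its explicit similarity can be inverted when new vertices arrive, which
    an equality of fibres does not offer directly. *)
Definition rigid n (F : framework R n) :=
  forall q, matches (graph F) (partA F) (pos F) q ->
  exists c d, c != 0 /\ forall u, q u = csim c d (pos F u).

(** If the cross product vanished, the line through [p u] and [p v] would contain all three points.
    The set [S] is only bounded by the three vertices, so it need not be computed explicitly. *)
Lemma noncollinear_cross n (p : 'I_n -> 'rV[R]_2) (S : {set 'I_n}) u v w :
  injective p -> u != v -> (forall i, i \in S -> [\/ i = u, i = v | i = w]) ->
  ~ collinear p S -> cross (p u - p v) (p u - p w) != 0.
Proof.
move=> p_inj uv Suvw ncol; apply/negP => /eqP hc; apply: ncol.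
set d := p u - p v.
have d0 : d != 0 by rewrite subr_eq0 (inj_eq p_inj).
exists (p u), d; split=> // i /Suvw [] ->.
- by exists 0; rewrite scale0r addr0.
- by exists (-1); rewrite scaleN1r opprB addrC subrK.
have dd : dot d d != 0 by rewrite dot_eq0.
(* The coefficient of the orthogonal projection of [p w - p u] on [d]; the orthogonal remainder is a
   multiple of the vanishing cross product. *)
exists (dot (p w - p u) d / dot d d).
suff -> : (dot (p w - p u) d / dot d d) *: d = p w - p u by rewrite addrC subrK.
have {}hc : cross d (p w - p u) = 0.
  by rewrite -[p w - p u]opprB -crossNN opprK -/d; move: hc; rewrite /cross !mxE => hc; lra.
set e := p w - p u in hc *; apply: (scalerI dd); rewrite scalerA mulrC divfK //.
move: hc; clearbody d e; rewrite !dotE /cross => hc.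
apply: vec2P; rewrite !mxE.
  transitivity ((d 0 0 * d 0 0 + d 0 1 * d 0 1) * e 0 0 + d 0 1 * (d 0 0 * e 0 1 - d 0 1 * e 0 0)).
    by ring.
  by rewrite hc; ring.
transitivity ((d 0 0 * d 0 0 + d 0 1 * d 0 1) * e 0 1 - d 0 0 * (d 0 0 * e 0 1 - d 0 1 * e 0 0)).
  by ring.
by rewrite hc; ring.
Qed.

(** * From old vertices to new ones in an extension *)

Section Extension.
Variables (n k : nat) (F : framework R n) (F' : framework R (n + k)).
Hypothesis ext : extends F F'.
Hypothesis deg : forall u, exists v, graph F u v.

Lemma matches_restrict q :
  matches (graph F') (partA F') (pos F') q ->
  matches (graph F) (partA F) (pos F) (q \o lshift k).
Proof.
have [eG eA eP] := ext; move=> [qd qa qr].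
split=> [u v uv|u v w uA uv uw vw|u v w uA uv uw vw] /=.
- by apply: qd; rewrite eG.
- by rewrite -!eP; apply: qa; rewrite ?eG ?eA ?(inj_eq (@lshift_inj _ _)).
- by rewrite -!eP; apply: qr; rewrite ?eG ?eA ?(inj_eq (@lshift_inj _ _)).
Qed.

(** Composing [q] with the inverse of the similarity found on the old vertices makes the old points
    agree with [pos F']; once the new ones agree too, the same similarity works for [F']. *)
Lemma extend_rigid :
  rigid F ->
  (forall q, matches (graph F') (partA F') (pos F') q ->
     (forall u, q (lshift k u) = pos F' (lshift k u)) ->
     forall x, q (rshift n x) = pos F' (rshift n x)) ->
  rigid F'.
Proof.
move=> rF new q mq; have [eG eA eP] := ext.
have [c [d [c0 qE]]] := rF _ (matches_restrict mq).
exists c, d; split=> //.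
have c'0 : cinv c != 0 by rewrite cinv_eq0.
(* Chosen so that [csim (cinv c) d'] is the map taking [v] to the quotient of [v - d] by [c], the
   inverse of [csim c d]. *)
pose d' := - cmul (cinv c) d.
have simE v : csim c d (csim (cinv c) d' v) = v.
  by rewrite /csim /d' -cmulBr cmulKV // subrK.
have old u : (csim (cinv c) d' \o q) (lshift k u) = pos F' (lshift k u).
  apply: (csim_inj (d := d) c0); rewrite /= simE.
  by have /= -> := qE u; rewrite eP.
have h := new _ (matches_csim d' c'0 mq) old.
by move=> u; case: (split_ordP u) => [u0 ->|u0 ->]; rewrite -?h -?old /= simE.
Qed.

Variable q : 'I_(n + k) -> 'rV[R]_2.
Hypothesis mq : matches (graph F') (partA F') (pos F') q.
Hypothesis old : forall u, q (lshift k u) = pos F' (lshift k u).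

Lemma old_neighbour u :
  exists2 v, graph F' (lshift k u) (lshift k v) &
    q (lshift k u) != q (lshift k v) /\ forall x : 'I_k, lshift k v != rshift n x.
Proof.
have [eG _ _] := ext; have [qd _ _] := mq; have [v uv] := deg u.
by exists v; [|split=> [|x]]; rewrite ?eq_lrshift ?qd ?eG.
Qed.

(** The arm from [u] to an old neighbour is already fixed, and the angle at [u] transfers its
    bearing to the arm towards the new vertex. *)
Lemma old_bearing u (x : 'I_k) :
  lshift k u \in partA F' -> graph F' (lshift k u) (rshift n x) ->
  bearing (pos F' (lshift k u)) (q (rshift n x)) =
  bearing (pos F' (lshift k u)) (pos F' (rshift n x)).
Proof.
move=> uA ux; have [v uv [quv vx]] := old_neighbour u; have [_ qa _] := mq.
rewrite -{1}old; apply: (same_angle_bearing quv (qa _ _ _ uA uv ux (vx x))).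
by rewrite !old.
Qed.

(** The length from [u] to an old neighbour is known and nonzero, so the ratio at [u] yields the
    other length. *)
Lemma old_dist u (x : 'I_k) :
  lshift k u \notin partA F' -> graph F' (lshift k u) (rshift n x) ->
  enorm (q (rshift n x) - pos F' (lshift k u)) =
  enorm (pos F' (rshift n x) - pos F' (lshift k u)).
Proof.
move=> uA ux; have [v uv [quv vx]] := old_neighbour u; have [_ _ qr] := mq.
have := qr _ _ _ uA uv ux (vx x); rewrite /same_ratio !old; apply: mulIf.
by rewrite enorm_eq0 subr_eq0 -!old eq_sym.
Qed.

Lemma old_adj u x : graph F' (lshift k u) (rshift n x) ->
  pos F' (lshift k u) != q (rshift n x).
Proof. by have [qd _ _] := mq; move/qd; rewrite old. Qed.

Lemma new_angle (x : 'I_k) i j :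
  rshift n x \in partA F' -> graph F' (rshift n x) (lshift k i) ->
  graph F' (rshift n x) (lshift k j) -> i != j ->
  same_angle (q (rshift n x)) (pos F' (lshift k i)) (pos F' (lshift k j))
    (pos F' (rshift n x)) (pos F' (lshift k i)) (pos F' (lshift k j)).
Proof.
move=> xA xi xj ij; rewrite -{1}(old i) -{1}(old j); have [_ qa _] := mq.
by apply: qa; rewrite ?(inj_eq (@lshift_inj _ _)).
Qed.

Lemma new_ratio (x : 'I_k) i j :
  rshift n x \notin partA F' -> graph F' (rshift n x) (lshift k i) ->
  graph F' (rshift n x) (lshift k j) -> i != j ->
  same_ratio (q (rshift n x)) (pos F' (lshift k i)) (pos F' (lshift k j))
    (pos F' (rshift n x)) (pos F' (lshift k i)) (pos F' (lshift k j)).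
Proof.
move=> xA xi xj ij; rewrite -{1}(old i) -{1}(old j); have [_ _ qr] := mq.
by apply: qr; rewrite ?(inj_eq (@lshift_inj _ _)).
Qed.

End Extension.

(** * The two kinds of vertex addition *)

Lemma one_vertex_new n (F : framework R n) (F' : framework R (n + 1)) q :
  (forall u, exists v, graph F u v) -> one_vertex_addition F F' ->
  matches (graph F') (partA F') (pos F') q ->
  (forall u, q (lshift 1 u) = pos F' (lshift 1 u)) ->
  q (rshift n ord0) = pos F' (rshift n ord0).
Proof.
move=> deg [ext [i [j [ij typ]]]] mq old.
have [eG eA eP] := ext.
have bear := old_bearing ext deg mq old; have dist := old_dist ext deg mq old.
have qadj := old_adj mq old; have ang := new_angle mq old; have rat := new_ratio mq old.
have gsym u v : graph F' u v = graph F' v u := @adj_sym _ _ u v.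
set x := rshift n ord0 in bear dist qadj ang rat *.
(* Types A1 and D1 single out one of [i], [j], called [a] here, so that each type becomes one case
   about an ordered pair. *)
suff new a b : a != b -> graph F' x (lshift 1 a) -> graph F' x (lshift 1 b) ->
    [\/ x \in partA F' /\ lshift 1 a \notin partA F',
        x \notin partA F' /\ lshift 1 a \in partA F',
        [/\ lshift 1 a \in partA F', lshift 1 b \in partA F' &
            ~ collinear (pos F') [set lshift 1 a; lshift 1 b; x]] |
        [/\ lshift 1 a \notin partA F', lshift 1 b \notin partA F' &
        exists c, [/\ graph F' x (lshift 1 c), lshift 1 c \notin partA F' &
            ~ collinear (pos F) [set a; b; c]]]] -> q x = pos F' x.
  have ji : j != i by rewrite eq_sym.
  have edges (N : {set 'I_n}) : joined_to F' ord0 N -> i \in N -> j \in N ->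
      graph F' x (lshift 1 i) /\ graph F' x (lshift 1 j) by move=> J; rewrite !J.
  case: typ => [[J xA ijD]|[J xD ijA]|[J xA iA jA nc]|[c [[ci cj J] [xD iD jD cD nc]]]];
    have [||xi xj] := edges _ J; rewrite ?inE ?eqxx ?orbT //.
  - by case: ijD; rewrite inE -eA => nA; [apply: (new i j)|apply: (new j i)] => //; apply: Or41.
  - rewrite inE in xD.
    by case: ijA; rewrite -eA => A; [apply: (new i j)|apply: (new j i)] => //; apply: Or42.
  - by apply: (new i j) => //; apply: Or43; rewrite !eA.
  - rewrite !inE -!eA in iD jD cD; apply: (new i j) => //; apply: Or44; split=> //.
    by exists c; rewrite J !inE eqxx orbT.
move=> ab xa xb.
have ax : graph F' (lshift 1 a) x by rewrite gsym.
have bx : graph F' (lshift 1 b) x by rewrite gsym.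
have pab : pos F' (lshift 1 a) != pos F' (lshift 1 b).
  by rewrite (inj_eq (@pos_inj _ _ F')) (inj_eq (@lshift_inj _ _)).
have := (pos_adj ax, qadj _ _ ax, pos_adj bx, qadj _ _ bx) => -[[[pax qax] pbx] qbx].
(* An old vertex in V_D gives a circle around it, one in V_A a ray. The measurement at [x] is used
   in the first two cases; two rays, respectively three circles, suffice in the others. *)
case=> [[xA aD]|[xD aA]|[aA bA nc]|[aD bD [c [xc cD nc]]]].
- have [bA|bD] := boolP (lshift 1 b \in partA F').
    exact: (dist_bearing_angle pax qax pbx qbx (dist _ _ aD ax) (bear _ _ bA bx) (ang _ _ _ xA xa xb ab)).
  exact: (dist_angle pab pax qax pbx qbx (dist _ _ aD ax) (dist _ _ bD bx) (ang _ _ _ xA xa xb ab)).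
- have [bA|bD] := boolP (lshift 1 b \in partA F').
    exact: (bearing_ratio pab pax qax pbx qbx (bear _ _ aA ax) (bear _ _ bA bx) (rat _ _ _ xD xa xb ab)).
  exact: (dist_bearing_ratio pax qax pbx qbx (bear _ _ aA ax) (dist _ _ bD bx) (rat _ _ _ xD xa xb ab)).
- apply: (bearing_meet pax qax pbx qbx _ (bear _ _ aA ax) (bear _ _ bA bx)).
  apply: (noncollinear_cross (@pos_inj _ _ F') (adj_neq xa) _ nc) => y.
  by rewrite !inE => /orP[/orP[]|] /eqP ->; [apply: Or32|apply: Or33|apply: Or31].
- have cx : graph F' (lshift 1 c) x by rewrite gsym.
  apply: (dist3 _ (dist _ _ aD ax) (dist _ _ bD bx) (dist _ _ cD cx)).
  rewrite !eP; apply: (noncollinear_cross (@pos_inj _ _ F) ab _ nc) => y.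
  by rewrite !inE => /orP[/orP[]|] /eqP ->; [apply: Or31|apply: Or32|apply: Or33].
Qed.

Lemma two_vertex_new n (F : framework R n) (F' : framework R (n + 2)) q :
  (forall u, exists v, graph F u v) -> two_vertex_addition F F' ->
  matches (graph F') (partA F') (pos F') q ->
  (forall u, q (lshift 2 u) = pos F' (lshift 2 u)) ->
  q (rshift n ord0) = pos F' (rshift n ord0) /\
  q (rshift n ord_max) = pos F' (rshift n ord_max).
Proof.
move=> deg [ext [i [j [ij [J1 x12 J2] _ nc /eqP/cards1P[d dE]]]]] mq old.
have [qd qa qr] := mq.
have bear := old_bearing ext deg mq old; have dist := old_dist ext deg mq old.
have qadj := old_adj mq old.
have gsym u v : graph F' u v = graph F' v u := @adj_sym _ _ u v.
set x1 := rshift n ord0 in J1 x12 nc dE *; set x2 := rshift n ord_max in J2 x12 nc dE *.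
have jx1 : graph F' (lshift 2 j) x1 by rewrite gsym J1 inE.
have ix2 : graph F' (lshift 2 i) x2 by rewrite gsym J2 inE.
have x1j : graph F' x1 (lshift 2 j) by rewrite gsym.
have x2i : graph F' x2 (lshift 2 i) by rewrite gsym.
have x21 : graph F' x2 x1 by rewrite gsym.
have lr u (x : 'I_2) : (lshift 2 u == rshift n x) = false by exact: eq_lrshift.
have rl u (x : 'I_2) : (rshift n x == lshift 2 u) = false by exact: eq_rlshift.
have lij : (lshift 2 i == lshift 2 j) = false.
  by rewrite (inj_eq (@lshift_inj _ _)) (negPf ij).
have n12 : (x1 == x2) = false := negbTE (adj_neq x12).
(* Among the four vertices of the path, [d] is the only one in V_D. *)
have D y : y \in [set lshift 2 i; lshift 2 j; x1; x2] -> (y \notin partA F') = (y == d).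
  by move=> yQ; have := congr1 (fun B : {set _} => y \in B) dE; rewrite finset.in_setI yQ finset.in_setC finset.in_set1.
have {D} [iD jD D1 D2] : [/\ (lshift 2 i \notin partA F') = (lshift 2 i == d),
    (lshift 2 j \notin partA F') = (lshift 2 j == d),
    (x1 \notin partA F') = (x1 == d) & (x2 \notin partA F') = (x2 == d)].
  by split; apply: D; rewrite !inE eqxx ?orbT.
have {dE} dQ : d \in [set lshift 2 i; lshift 2 j; x1; x2].
  by have := set11 d; rewrite -dE inE => /andP[].
have ncE u v w : u != v ->
    (forall y, y \in [set lshift 2 i; lshift 2 j; x1; x2] -> y \in partA F' ->
       [\/ y = u, y = v | y = w]) -> cross (pos F' u - pos F' v) (pos F' u - pos F' w) != 0.
  move=> uv H; apply: (noncollinear_cross (@pos_inj _ _ F') uv _ nc) => y.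
  by rewrite inE => /andP[/H].
have pjx := pos_adj jx1; have pix := pos_adj ix2; have p12 := pos_adj x12.
have qjx := qadj _ _ jx1; have qix := qadj _ _ ix2; have q12 := qd _ _ x12.
have p21 := pos_adj x21; have q21 := qd _ _ x21.
have a1 : x1 \in partA F' ->
    same_angle (q x1) (pos F' (lshift 2 j)) (q x2)
      (pos F' x1) (pos F' (lshift 2 j)) (pos F' x2).
  by move=> A1; rewrite -{1}old; apply: qa; rewrite ?lr.
have a2 : x2 \in partA F' ->
    same_angle (q x2) (q x1) (pos F' (lshift 2 i))
      (pos F' x2) (pos F' x1) (pos F' (lshift 2 i)).
  by move=> A2; rewrite -{1}old; apply: qa; rewrite ?rl.
have r1 : x1 \notin partA F' ->
    same_ratio (q x1) (pos F' (lshift 2 j)) (q x2)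
      (pos F' x1) (pos F' (lshift 2 j)) (pos F' x2).
  by move=> A1; rewrite -{1}old; apply: qr; rewrite ?lr.
have r2 : x2 \notin partA F' ->
    same_ratio (q x2) (q x1) (pos F' (lshift 2 i))
      (pos F' x2) (pos F' x1) (pos F' (lshift 2 i)).
  by move=> A2; rewrite -{1}old; apply: qr; rewrite ?rl.
have {lr rl} := (lr, rl, lij, n12, eq_sym x2 x1, eq_sym (lshift 2 j) (lshift 2 i)) => neq.
(* The vertex in V_D is [i], [j], [x1] or [x2] in turn. Reading the path backwards exchanges [i]
   with [j] and [x1] with [x2], so the second and fourth cases reuse the lemmas of the first and
   third. *)
move: dQ; rewrite !inE => /orP[/orP[/orP[]|]|] /eqP dE; subst d;
  move: iD jD D1 D2; rewrite !eqxx ?neq => iD jD D1 D2.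
- move/negbFE in jD; move/negbFE in D1; move/negbFE in D2.
  apply: (quad_end pjx qjx p12 q12 pix qix _ (dist _ _ iD ix2) (bear _ _ jD jx1) (a1 D1) (a2 D2)).
  apply: ncE => [|y]; first by rewrite neq.
  rewrite !inE => /orP[/orP[/orP[]|]|] /eqP ->; rewrite ?(negPf iD) // => _;
    by [apply: Or31|apply: Or32|apply: Or33].
- move/negbFE in iD; move/negbFE in D1; move/negbFE in D2.
  apply/and_comm.
  apply: (quad_end pix qix p21 q21 pjx qjx _ (dist _ _ jD jx1) (bear _ _ iD ix2)
    (same_angleC (a2 D2)) (same_angleC (a1 D1))).
  apply: ncE => [|y]; first by rewrite neq.
  rewrite !inE => /orP[/orP[/orP[]|]|] /eqP ->; rewrite ?(negPf jD) // => _;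
    by [apply: Or31|apply: Or32|apply: Or33].
- move/negbFE in iD; move/negbFE in jD; move/negbFE in D2.
  apply: (quad_mid pjx qjx p12 q12 pix qix _ (bear _ _ iD ix2) (bear _ _ jD jx1) (r1 D1) (a2 D2)).
  apply: ncE => [|y]; first by rewrite neq.
  rewrite !inE => /orP[/orP[/orP[]|]|] /eqP ->; rewrite ?(negPf D1) // => _;
    by [apply: Or31|apply: Or32|apply: Or33].
- move/negbFE in iD; move/negbFE in jD; move/negbFE in D1.
  apply/and_comm.
  apply: (quad_mid pix qix p21 q21 pjx qjx _ (bear _ _ jD jx1) (bear _ _ iD ix2)
    (same_ratioC (r2 D2)) (same_angleC (a1 D1))).
  apply: ncE => [|y]; first by rewrite neq.
  rewrite !inE => /orP[/orP[/orP[]|]|] /eqP ->; rewrite ?(negPf D2) // => _;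
    by [apply: Or31|apply: Or32|apply: Or33].
Qed.

(** * Induction along the ordering *)

Lemma edge_rigid (F : framework R 2) : graph F ord0 ord_max -> rigid F.
Proof.
move=> e q [qd _ _].
have p01 : pos F ord_max - pos F ord0 != 0 by rewrite subr_eq0 eq_sym (pos_adj e).
(* The quotient of the two edge vectors as complex numbers; the translation is then forced by the
   image of the first point. *)
pose c := cmul (cinv (pos F ord_max - pos F ord0)) (q ord_max - q ord0).
have q01 : q ord_max - q ord0 != 0 by rewrite subr_eq0 eq_sym qd.
exists c, (q ord0 - cmul c (pos F ord0)); split.
  by rewrite cmul_eq0 cinv_eq0 negb_or p01.
move=> u; have [->|->] : u = ord0 \/ u = ord_max.
  by case: u => [[|[|//]] ?]; [left|right]; apply: val_inj.
  by rewrite /csim addrC subrK.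
by rewrite /csim addrCA -cmulBr [cmul c _]cmulC cmulKV // addrC subrK.
Qed.

(** The existence of neighbours is proved along with rigidity, since it supplies the known arm at
    each old vertex in the next addition. *)
Lemma ordering_rigid n (F : framework R n) :
  sarod_ordering F -> rigid F /\ forall u, exists v, graph F u v.
Proof.
elim=> {n F} [F e|n F F' _ [rF deg] add|n F F' _ [rF deg] add].
- split; first exact: edge_rigid.
  move=> u; have [->|->] : u = ord0 \/ u = ord_max.
  + by case: u => [[|[|//]] ?]; [left|right]; apply: val_inj.
  + by exists ord_max.
  + by exists ord0; rewrite adj_sym.
- have [ext [i [j [ij typ]]]] := add; split.
    apply: (extend_rigid ext rF) => q mq old x; rewrite [x]ord1.
    exact: one_vertex_new deg add mq old.
  have [eG _ _] := ext.
  have xi : graph F' (rshift n ord0) (lshift 1 i).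
    by case: typ => [[J]|[J]|[J]|[k [[_ _ J] _]]]; rewrite J !inE eqxx.
  move=> u; case: (split_ordP u) => [u0 ->|x ->].
    by have [v uv] := deg u0; exists (lshift 1 v); rewrite eG.
  by exists (lshift 1 i); rewrite [x]ord1.
have [ext [i [j [ij [J1 x12 J2] _ _ _]]]] := add.
have ord2 (x : 'I_2) : x = ord0 \/ x = ord_max.
  by case: x => [[|[|//]] ?]; [left|right]; apply: val_inj.
split.
  apply: (extend_rigid ext rF) => q mq old x.
  by have [h1 h2] := two_vertex_new deg add mq old; case: (ord2 x) => ->.
have [eG _ _] := ext.
move=> u; case: (split_ordP u) => [u0 ->|x ->].
  by have [v uv] := deg u0; exists (lshift 2 v); rewrite eG.
by case: (ord2 x) => ->; [exists (lshift 2 j); rewrite J1 inE|exists (lshift 2 i); rewrite J2 inE].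
Qed.

End Frameworks.

Theorem theorem8 (R : realType) (n : nat) (F : framework R n)
    (n_ge3 : (3 <= n)%N)
    (A_nonempty : exists u : 'I_n, u \in partA F)
    (D_nonempty : exists u : 'I_n, u \in partD F)
    (F_ordering : sarod_ordering F) :
  globally_sarod_rigid F.
Proof.
have [rF _] := ordering_rigid F_ordering.
apply/seteqP; split=> q qf.
  have [c [d [c0 qE]]] := rF _ (fibre_matches (@pos_inj _ _ F) qf).
  exact: csim_fibre (@pos_inj _ _ F) c0 qE.
(* Every edge joins distinct vertices, so a match for the complete graph is in particular a match
   for [graph F]. *)
have [qd qa qr] := fibre_matches (@pos_inj _ _ F) qf.
have [|c [d [c0 qE]]] := rF q; last exact: csim_fibre (@pos_inj _ _ F) c0 qE.
split=> [u v uv|u v w uA uv uw vw|u v w uA uv uw vw].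
- exact/qd/(adj_neq uv).
- exact: qa uA (adj_neq uv) (adj_neq uw) vw.
- exact: qr uA (adj_neq uv) (adj_neq uw) vw.
Qed.
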